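(* Let $0\le \ell<u$, let $f:[\ell,u]\to\mathbb{R}_{++}$ be convex, and let $\ell=:\xi_0<\xi_1<\cdots<\xi_n:=u$ ($n\ge 1$) be linearization points at which $f$ is differentiable. Let $\tau_0,\ldots,\tau_{n+1}$, $g$ and $\breve{U}^*_f(\boldsymbol\xi)$ be as defined in the context. Then $$\operatorname{vol}(\breve{U}^*_f(\boldsymbol\xi))=\frac{1}{6}\sum_{i=1}^n \left|\det\begin{pmatrix}\tau_0&\tau_i&\tau_{i+1}\\ g(\tau_0)&g(\tau_i)&g(\tau_{i+1})\\ 1&1&1\end{pmatrix}\right|.$$
   Context: Given $f$ and $\boldsymbol\xi=(\xi_0,\ldots,\xi_n)$, put $\tau_0:=\ell$, $\tau_{n+1}:=u$ and, for $i=1,\ldots,n$, $$\tau_i:=\frac{[f(\xi_i)-f'(\xi_i)\xi_i]-[f(\xi_{i-1})-f'(\xi_{i-1})\xi_{i-1}]}{f'(\xi_{i-1})-f'(\xi_i)},$$ the abscissa of the intersection point of the tangent lines to $f$ at $\xi_{i-1}$ and $\xi_i$. Let $P_0:=(\ell,f(\ell))$, $P_{n+1}:=(u,f(u))$ and $P_i:=(\tau_i,\ f(\xi_i)+f'(\xi_i)(\tau_i-\xi_i))$ for $i=1,\ldots,n$. Then $g:[\ell,u]\to\mathbb{R}$ is the piecewise-linear function whose graph connects $P_0,P_1,\ldots,P_{n+1}$ in this order (a convex under-estimator of $f$ agreeing with $f$ at the $\xi_i$). The set $\breve{U}^*_f(\boldsymbol\xi)$ is the perspective relaxation associated with $g$,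 that is, with $s:=\frac{g(u)-g(\ell)}{u-\ell}$, the convex closure of $$\left\{(x,y,z)\in\mathbb{R}^3:\ (g(\ell)-s\ell)z+sx\ge y\ge z\,g(x/z),\ uz\ge x\ge \ell z,\ 1\ge z>0,\ y\ge 0\right\}.$$ $\operatorname{vol}$ denotes 3-dimensional volume.
   Formalization: The formal theorem adds the hypothesis g ≥ 0 on [ℓ,u]; where g is negative somewhere, the constraint y ≥ 0 cuts off positive volume and the stated formula fails (e.g. f(x)=(x−1)²+1/10 on [0,2], n=1). *)

(* Defs.v *)
From HB Require Import structures.
From mathcomp Require Import all_boot all_order all_algebra.
From mathcomp Require Import all_classical all_reals all_analysis.
Set Implicit Arguments.
Unset Strict Implicit.
Unset Printing Implicit Defensive.
Import Order.TTheory GRing.Theory Num.Theory.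
Import numFieldNormedType.Exports.
Local Open Scope classical_set_scope.
Local Open Scope ring_scope.

Section Defs.
Variable R : realType.
Implicit Types (l u x : R) (f g : R -> R) (xi px py : nat -> R) (n i : nat).

(* Derivative of a function whose domain is [l, u]: the difference quotient is
   restricted to [l, u], so that it is two-sided at interior points and
   one-sided at l and u; values of f outside [l, u] are irrelevant. *)
Definition quotient_filter l u f x : set_system R :=
  (fun y => (f y - f x) / (y - x)) @ within `[l, u] x^'.

Definition derivable_on l u f x : Prop := cvg (quotient_filter l u f x).

Definition derive_on l u f x : R := lim (quotient_filter l u f x).

(* If the slopes at xi_(i-1) and xi_i agree, the two tangent lines coincide
   (f being convex) and the quotient is 0/0; every point of
   [xi_(i-1), xi_i] is then the abscissa of an intersection point, and all
   choices induce the same function g. We take the midpoint. *)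
Definition tau l u f n xi i : R :=
  let f' := derive_on l u f in
  if i == 0%N then l
  else if i == n.+1 then u
  else if f' (xi i.-1) == f' (xi i) then (xi i.-1 + xi i) / 2
  else ((f (xi i) - f' (xi i) * xi i)
        - (f (xi i.-1) - f' (xi i.-1) * xi i.-1))
       / (f' (xi i.-1) - f' (xi i)).

Definition ordinate l u f n xi i : R :=
  if i == 0%N then f l
  else if i == n.+1 then f u
  else f (xi i) + derive_on l u f (xi i) * (tau l u f n xi i - xi i).

(* The function on [px 0, px m] whose graph connects the points (px i, py i),
   i = 0, ..., m, in this order, for px increasing. *)
Fixpoint piecewise_linear px py (m : nat) (x : R) : R :=
  if m is k.+1 then
    if x <= px k then piecewise_linear px py k x
    else py k + (py k.+1 - py k) / (px k.+1 - px k) * (x - px k)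
  else py 0%N.

Definition under_estimator l u f n xi : R -> R :=
  piecewise_linear (tau l u f n xi) (ordinate l u f n xi) n.+1.

Definition convex_closure (S : set (R * R * R)) : set (R * R * R) :=
  smallest [set C : set (R * R * R) | closed C /\ convex_set C] S.

Definition perspective_relaxation l u g : set (R * R * R) :=
  let s := (g u - g l) / (u - l) in
  convex_closure
    [set p | let: (x, y, z) := p in
       [/\ z * g (x / z) <= y <= (g l - s * l) * z + s * x,
           l * z <= x <= u * z,
           0 < z <= 1
         & 0 <= y]].

Definition volume (A : set (R * R * R)) : \bar R :=
  ((@lebesgue_measure R \x @lebesgue_measure R) \x @lebesgue_measure R)%E A.

Definition mx33 (rows : seq (seq R)) : 'M[R]_3 :=
  \matrix_(i < 3, j < 3) (nth [::] rows i)`_j.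

End Defs.

(* Main.v *)
Require Import Defs.
From HB Require Import structures.
From mathcomp Require Import all_boot all_order all_algebra.
From mathcomp Require Import all_classical all_reals all_analysis.
From mathcomp Require Import measurable_realfun ring lra.
Set Implicit Arguments.
Unset Strict Implicit.
Unset Printing Implicit Defensive.
Import Order.TTheory GRing.Theory Num.Theory.
Import numFieldNormedType.Exports.
Local Open Scope classical_set_scope.
Local Open Scope ring_scope.

(** The set is a pyramid.  The graph of [g] is a convex polygonal path whose
    edge number [i] lies on the tangent line of [f] at [xi i], so on
    [[l, u]] the function [g] is the maximum of these tangent lines, and for
    [z > 0] the perspective [z * g (x / z)] is the maximum of the linear forms
    [a i * x + b i * z].  Hence the set before closure is exactly the part
    [z > 0] of a polyhedron: the cone with apex [0] over the polygon [G] between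
    [g] and its chord, cut off at height [z = 1].  The polyhedron is closed and
    convex, and its only point of height [0] is the apex, a limit of points with
    [z > 0]; so it is the convex closure
    ([perspective_relaxation_pyramid]).

    Its slice at height [z] is [z * G], of area [z ^ 2 * area G], so by Tonelli
    its volume is [area G / 3] ([volume_pyramid]).  The area of [G] is computed
    with trapezoids between consecutive breakpoints of [g]; summation by parts
    turns this sum into the fan of triangles with common vertex
    [(l, g l)] ([trapezoid_fan_sum]), whose doubled areas are the determinants
    of the statement; they all have the same sign since [g] is convex
    ([volume_perspective_polygonal]).

    Convexity of [f] enters only through the fact that its graph lies above its
    tangent lines ([tangent_le]).  Comparing two consecutive tangents with [f]
    at both points of tangency shows that the slopes increase and that the
    tangents meet between these points, which makes [g] a convex polygonal
    path. *)

(** * One-dimensional integrals *)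

Lemma integral_primitive (R : realType) (F f : R -> R) (a b : R) :
  a <= b -> (forall x, is_derive x (1 : R) F (f x)) -> continuous f ->
  (\int[lebesgue_measure]_(x in `[a, b]) (f x)%:E = (F b - F a)%:E)%E.
Proof.
rewrite le_eqVlt => /predU1P[-> _ _|ab dF cf].
  by rewrite set_itv1 integral_set1 subrr.
have cF : continuous F.
  move=> x; apply: differentiable_continuous.
  by apply/derivable1_diffP; case: (dF x).
rewrite EFinB; apply: continuous_FTC2 => //.
- exact: continuous_subspaceT.
- split => [x _||]; [by case: (dF x)| |].
  + exact/cvg_at_right_filter/cF.
  + exact/cvg_at_left_filter/cF.
- by move=> x _; rewrite derive1E; apply: derive_val.
Qed.

Lemma integral_affine (R : realType) (p q a b : R) : a <= b ->
  (\int[lebesgue_measure]_(x in `[a, b]) (p * x + q)%:E =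
   ((b - a) * ((p * a + q) + (p * b + q)) / 2)%:E)%E.
Proof.
move=> ab.
have dF (x : R) :
    is_derive x 1 (fun x : R => p / 2 * x ^+ 2 + q * x) (p * x + q).
  by apply: is_derive_eq; rewrite /GRing.scale/=; field.
rewrite (integral_primitive ab dF); first by congr EFin; field.
move=> x; apply: cvgD; last exact: cvg_cst.
by apply: cvgM; [exact: cvg_cst|exact: cvg_id].
Qed.

Lemma integral_sqr01 (R : realType) (c : R) :
  (\int[lebesgue_measure]_(z in `[0%R, 1%R]) (c * z ^+ 2)%:E = (c / 3)%:E)%E.
Proof.
have dF (x : R) : is_derive x 1 (fun x : R => c / 3 * x ^+ 3) (c * x ^+ 2).
  by apply: is_derive_eq; rewrite /GRing.scale/=; field.
rewrite (integral_primitive ler01 dF); first by congr EFin; field.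
by move=> x; apply: cvgM; [exact: cvg_cst|exact: exprn_continuous].
Qed.

(** Consecutive closed intervals overlap at the nodes only, which are null
    sets. *)
Lemma ge0_integral_itv_nodes (R : realType) (p : nat -> R) (m : nat)
    (F : R -> \bar R) :
  (forall i, (i < m)%N -> p i <= p i.+1) ->
  measurable_fun [set: R] F -> (forall x, (0 <= F x)%E) ->
  (\int[lebesgue_measure]_(x in `[p 0%N, p m]) F x =
   \sum_(i < m) \int[lebesgue_measure]_(x in `[p i, p i.+1]) F x)%E.
Proof.
move=> + mF F0; elim: m => [_|m IH pS].
  by rewrite set_itv1 integral_set1 big_ord0.
have /(_ m (leqnn m)) p0m : forall k, (k <= m)%N -> p 0%N <= p k.
  elim=> // k IHk km.
  by rewrite (le_trans (IHk (ltnW km)))// pS// ltnW.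
rewrite big_ord_recr/= -IH; last by move=> i im; apply/pS/ltnW.
rewrite (@itv_bndbnd_setU _ _ _ (BRight (p m))) ?bnd_simp ?pS//.
rewrite ge0_integral_setU//=; last 2 first.
- exact: measurable_funTS.
- apply/disj_setPS => x [/=]; rewrite !in_itv/= => /andP[_ xm] /andP[mx _].
  by rewrite ltNge xm in mx.
congr adde.
by rewrite integral_itv_obnd_cbnd//; exact: measurable_funTS.
Qed.

(** * Polyhedra in space *)

Definition halfspace (R : realType) (p q r d : R) : set (R * R * R) :=
  [set v | p * v.1.1 + q * v.1.2 + r * v.2 <= d].

Lemma closed_halfspace (R : realType) (p q r d : R) :
  closed (halfspace p q r d).
Proof.
pose h (v : R * R * R) := p * v.1.1 + q * v.1.2 + r * v.2.
have ch : continuous h.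
  move=> v; apply: cvgD; [apply: cvgD|]; apply: cvgM; try exact: cvg_cst.
  - apply: (@cvg_comp _ _ _ fst fst); exact: cvg_fst.
  - apply: (@cvg_comp _ _ _ fst snd); [exact: cvg_fst|exact: cvg_snd].
  - exact: cvg_snd.
have -> : halfspace p q r d = h @^-1` [set x | x <= d] by [].
exact: (continuous_closedP _).1 ch _ (@closed_le _ d).
Qed.

Lemma convex_halfspace (R : realType) (p q r d : R) :
  convex_set (halfspace p q r d).
Proof.
move=> [[x y] z] [[x' y'] z'] k; rewrite !inE /halfspace/= => hv hw.
have k0 : 0 <= k%:num by [].
have k1 : 0 <= 1 - k%:num by rewrite subr_ge0.
move: k0 k1 (ler_wpM2l k0 hv) (ler_wpM2l k1 hw).
move: (k%:num : R) => t t0 t1 h h'.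
change (p * (t * x + (1 - t) * x') + q * (t * y + (1 - t) * y') +
        r * (t * z + (1 - t) * z') <= d).
lra.
Qed.

Lemma measurable_halfspace (R : realType) (p q r d : R) :
  measurable (halfspace p q r d).
Proof.
rewrite -[X in measurable X]setTI.
apply: measurable_fun_le => //.
apply: measurable_funD => //; first apply: measurable_funD => //;
  apply: measurable_funM => //.
- exact: measurableT_comp.
- exact: measurableT_comp.
Qed.

Lemma convex_setI (R : numDomainType) (M : lmodType R)
    (A B : set (convex_lmodType M)) :
  convex_set A -> convex_set B -> convex_set (A `&` B).
Proof.
move=> cA cB v w k; rewrite !in_setI => /andP[vA vB] /andP[wA wB].
by rewrite cA ?cB.
Qed.

Lemma convex_bigcap (R : numDomainType) (M : lmodType R) (I : Type)
    (D : set I) (A : I -> set (convex_lmodType M)) :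
  (forall i, D i -> convex_set (A i)) -> convex_set (\bigcap_(i in D) A i).
Proof.
move=> cA v w k /set_mem vA /set_mem wA; apply/mem_set => i Di.
by apply/set_mem/cA => //; apply/mem_set; [exact: vA|exact: wA].
Qed.

(** The cone with apex [0] over the polygon between the upper envelope of the
    lines [a i * x + b i] and the roof [c + s * x] on [[l, u]], cut at
    height [1].  Written with linear inequalities, it makes sense at the apex
    too, where [x / z] does not. *)
Definition pyramid (R : realType) (l u : R) (n : nat) (a b : nat -> R)
    (c s : R) : set (R * R * R) :=
  [set v | let: (x, y, z) := v in
     [/\ 0 <= z <= 1, l * z <= x <= u * z,
         forall i, (i <= n)%N -> a i * x + b i * z <= y & y <= c * z + s * x]].

Lemma pyramidE (R : realType) (l u : R) (n : nat) (a b : nat -> R) (c s : R) :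
  pyramid l u n a b c s =
  (\bigcap_(i in [set i | (i <= n)%N]) halfspace (a i) (-1) (b i) 0) `&`
  halfspace (- s) 1 (- c) 0 `&` (halfspace (-1) 0 l 0 `&` halfspace 1 0 (- u) 0)
  `&` (halfspace 0 0 (-1) 0 `&` halfspace 0 0 1 1).
Proof.
rewrite eqEsubset; split=> [[[x y] z] [/andP[z0 z1] /andP[xl xu] ay yc]|].
  split; [split; [split|split]|split]; rewrite /halfspace/=; try lra.
  by move=> i /= ni; rewrite /halfspace/=; have := ay _ ni; lra.
move=> [[x y] z] [[[ay]]]; rewrite /halfspace/= => yc [xl xu] [z0 z1].
split; [lra|lra| |lra] => i ni.
by have := ay i ni; rewrite /halfspace/=; lra.
Qed.

Lemma closed_pyramid (R : realType) (l u : R) (n : nat) (a b : nat -> R)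
  (c s : R) : closed (pyramid l u n a b c s).
Proof.
rewrite pyramidE; do !apply: closedI; try exact: closed_halfspace.
by apply: closed_bigI => i _; exact: closed_halfspace.
Qed.

Lemma convex_pyramid (R : realType) (l u : R) (n : nat) (a b : nat -> R)
  (c s : R) : convex_set (pyramid l u n a b c s).
Proof.
rewrite pyramidE; do !apply: convex_setI; try exact: convex_halfspace.
by apply: convex_bigcap => i _; exact: convex_halfspace.
Qed.

Lemma measurable_pyramid (R : realType) (l u : R) (n : nat) (a b : nat -> R)
  (c s : R) : measurable (pyramid l u n a b c s).
Proof.
rewrite pyramidE; do !apply: measurableI; try exact: measurable_halfspace.
by apply: bigcap_measurable => [|i _]; [exists 0%N|exact: measurable_halfspace].
Qed.

(** Multiplying by [z > 0] identifies [z * g (x / z) <= y] with the linear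
    inequalities of the pyramid, so the set before closure is the pyramid
    without its apex.  The apex is the limit of the points
    [z *: (l, g l, 1)]; the pyramid being closed and convex, nothing else is
    added. *)
Lemma perspective_relaxation_pyramid (R : realType) (l u : R) (n : nat)
    (a b : nat -> R) (g : R -> R) : l < u ->
  (forall x, l <= x <= u -> 0 <= g x) ->
  (forall x i, l <= x <= u -> (i <= n)%N -> a i * x + b i <= g x) ->
  (forall x, l <= x <= u -> exists2 i, (i <= n)%N & g x = a i * x + b i) ->
  let s := (g u - g l) / (u - l) in
  perspective_relaxation l u g = pyramid l u n a b (g l - s * l) s.
Proof.
move=> lu g0 ag gE s; rewrite /perspective_relaxation -/s.
set c := g l - s * l; set S := (X in convex_closure X).
have sl : s * l + c = g l by rewrite /c; ring.
have scale x z : 0 < z -> l * z <= x <= u * z -> l <= x / z <= u.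
  by move=> z0 /andP[lx xu]; rewrite ler_pdivlMr// ler_pdivrMr// lx.
have KS x y z : S (x, y, z) <-> pyramid l u n a b c s (x, y, z) /\ 0 < z.
  rewrite /S/pyramid/=; split.
    move=> [/andP[gy yc] xlu /andP[z0 z1] y0]; split; last by [].
    split=> //; first by rewrite (ltW z0).
    move=> i ni; apply: le_trans gy.
    have /(ler_wpM2l (ltW z0)) := ag (x / z) i (scale _ _ z0 xlu) ni.
    by rewrite mulrDr mulrCA [z * (x / z)]mulrC divfK ?gt_eqF// [z * b i]mulrC.
  move=> [[/andP[_ z1] xlu ay yc] z0].
  have xz := scale _ _ z0 xlu.
  have gy : z * g (x / z) <= y.
    have [i ni ->] := gE _ xz.
    apply: le_trans (ay i ni).
    by rewrite mulrDr mulrCA [z * (x / z)]mulrC divfK ?gt_eqF// [z * b i]mulrC.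
  split=> //; first by rewrite gy.
    by rewrite z0.
  by apply: le_trans gy; rewrite mulr_ge0 ?g0// ltW.
rewrite eqEsubset; split.
  apply: smallest_sub.
    by split; [exact: closed_pyramid|exact: convex_pyramid].
  by move=> [[x y] z] /KS[].
move=> [[x y] z] K C [[cC _] SC].
have [z0|z0] := ltP 0 z; first by apply/SC/KS.
(* A point of height 0 is the apex: the side walls give x = 0, then any line and
   the roof give y = 0. *)
have K' := K; case: K' => /andP[z0' _] xlu ay yc.
have z00 : z = 0 by apply/eqP; rewrite eq_le z0.
rewrite z00 in xlu ay yc *.
have x0 : x = 0 by lra.
rewrite x0 in ay yc *.
have y0 : y = 0 by have := ay 0%N (leq0n _); lra.
rewrite y0.
apply: (@closed_cvg _ _ (0^'+ : set_system R) _
  (fun t : R => (l * t, g l * t, t)) C cC) => //.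
  near=> t; apply/SC/KS; split; last by [].
  have t0 : 0 < t by [].
  have t1 : t <= 1 by near: t; exact: nbhs_right_le.
  have lul : l <= l <= u by rewrite lexx ltW.
  split.
  - by rewrite t1 ltW.
  - by rewrite lexx ler_wpM2r// ltW.
  - move=> i ni; have /(ler_wpM2r (ltW t0)) := ag l i lul ni.
    by rewrite mulrDl mulrA.
  - by rewrite -sl; lra.
have -> : (0, 0, 0) = (l * 0, g l * 0, 0) :> R * R * R by rewrite !mulr0.
apply: cvg_within_filter.
apply: (@cvg_pair _ _ _ _ (nbhs (l * 0, g l * 0)) (nbhs (0 : R)));
  last exact: cvg_id.
by apply: (@cvg_pair _ _ _ _ (nbhs (l * 0)) (nbhs (g l * 0))); apply: cvgM;
  (exact: cvg_cst || exact: cvg_id).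
Unshelve. all: by end_near. Qed.

(** * The volume of the pyramid *)

(** A constant of its own, so that a sigma-finite structure can be attached to
    it: for a bare product, unification looks for factors that are
    subprobabilities. *)
Definition plane_measure (R : realType) :
    set (measurableTypeR R * measurableTypeR R) -> \bar R :=
  (@lebesgue_measure R \x @lebesgue_measure R)%E.

HB.instance Definition _ (R : realType) :=
  Measure.copy (@plane_measure R)
    (@lebesgue_measure R \x @lebesgue_measure R)%E.

(** The plane is the union of the squares of side [2 * k]. *)
Lemma sigma_finite_plane_measure (R : realType) :
  sigma_finite [set: measurableTypeR R * measurableTypeR R] (@plane_measure R).
Proof.
pose I (k : nat) : set (measurableTypeR R) := [set` `[- k%:R, k%:R : R]].
exists (fun k => I k `*` I k).
  apply/esym; rewrite -subTset => -[x y] _.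
  have [j xj] : exists j : nat, `|x| <= j%:R.
    by exists (Num.bound x); exact/ltW/unstable.ltr_norm_bound.
  have [k yk] : exists k : nat, `|y| <= k%:R.
    by exists (Num.bound y); exact/ltW/unstable.ltr_norm_bound.
  exists (j + k)%N => //; split; rewrite /I/= in_itv/= -ler_norml natrD.
  - by rewrite (le_trans xj)// lerDl.
  - by rewrite (le_trans yk)// lerDr.
move=> k; have mI : measurable (I k) by exact: measurable_itv.
have Ioo : (lebesgue_measure (I k) < +oo)%E.
  by rewrite /I lebesgue_measure_itv/=; case: ifP => _; rewrite -?EFinB ltry.
split; first exact: measurableX.
by rewrite /plane_measure product_measure1E// lte_mul_pinfty// ge0_fin_numE.
Qed.

HB.instance Definition _ (R : realType) :=
  Measure_isSigmaFinite.Build _ _ _ (@plane_measure R)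
    (@sigma_finite_plane_measure R).

(** By definition the volume integrates the lengths of the fibers over the
    plane.  The slices of a cone at constant height are similar to each other,
    which makes the opposite order of integration the convenient one. *)
Lemma volume_slices (R : realType) (A : set (R * R * R)) :
  @measurable _ (measurableTypeR R * measurableTypeR R * measurableTypeR R)%type
    A ->
  volume A = (\int[lebesgue_measure]_z plane_measure (ysection A z))%E.
Proof.
move=> mA; transitivity ((@plane_measure R \x^ @lebesgue_measure R)%E A) => //.
apply: (@product_measure_unique _ _ _ _ _ (@plane_measure R)) => //.
by move=> X Y mX mY; rewrite /= product_measure2E.
Qed.

Section PyramidVolume.
Variables (R : realType) (l u : R) (n : nat) (t a b : nat -> R) (c s : R).
Hypothesis t0 : t 0%N = l.
Hypothesis tn : t n.+1 = u.
Hypothesis t_le : forall i, (i <= n)%N -> t i <= t i.+1.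
Hypothesis lines_le : forall i j x, (i <= n)%N -> (j <= n)%N ->
  t i <= x <= t i.+1 -> a j * x + b j <= a i * x + b i.
Hypothesis line_le_roof : forall i x, (i <= n)%N ->
  t i <= x <= t i.+1 -> a i * x + b i <= c + s * x.

Let gap i x := c + s * x - (a i * x + b i).

Let area := \sum_(i < n.+1)
  (t i.+1 - t i) * (gap i (t i) + gap i (t i.+1)) / 2.

Let P := pyramid l u n a b c s.

Let fiberE (x y z : R) : xsection (ysection P z) x y = P (x, y, z).
Proof.
by apply/propext; split=> [/set_mem/set_mem|yP]; last exact/mem_set/mem_set.
Qed.

(** Scaled by [z], line [i] is still the highest one between the scaled
    breakpoints [t i * z] and [t i.+1 * z]; at [z = 0] both breakpoints are [0]
    and the comparison is trivial. *)
Lemma fiber_pyramid (i : nat) (x z : R) : (i <= n)%N -> 0 <= z <= 1 ->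
  t i * z <= x <= t i.+1 * z ->
  lebesgue_measure (xsection (ysection P z) x) =
  ((s - a i) * x + (c - b i) * z)%:E.
Proof.
move=> ni /andP[z0 z1] xt.
have scale p q p' q' :
    (forall w, t i <= w <= t i.+1 -> p * w + q <= p' * w + q') ->
    p * x + q * z <= p' * x + q' * z.
  move=> pq; have [z_gt0|z_le0] := ltP 0 z; last first.
    have z00 : z = 0 by apply/eqP; rewrite eq_le z_le0.
    have -> : x = 0 by move: xt; rewrite z00; lra.
    by rewrite z00 !mulr0.
  have /(_ _)/(ler_wpM2r z0) := pq (x / z).
  rewrite !mulrDl -!(mulrA _ (x / z)) divfK ?gt_eqF//; apply.
  by rewrite ler_pdivlMr// ler_pdivrMr.
have ic : a i * x + b i * z <= s * x + c * z.
  by apply: scale => w wt; rewrite [leRHS]addrC line_le_roof.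
have -> : xsection (ysection P z) x =
    [set` `[a i * x + b i * z, c * z + s * x]].
  apply/seteqP; split=> y; rewrite fiberE /P /pyramid/= in_itv/=.
    by move=> [_ _ ay yc]; rewrite ay.
  move=> /andP[ay yc]; split=> //.
  - by rewrite z0.
  - have le_t j k : (j <= k)%N -> (k <= n.+1)%N -> t j <= t k.
      move=> jk; rewrite -(subnK jk); elim: (k - j)%N => // m IH mn.
      by rewrite (le_trans (IH (ltnW mn)))// t_le.
    have := le_t 0%N i (leq0n _) (leqW ni); rewrite t0 => /(ler_wpM2r z0).
    have := le_t i.+1 n.+1 ni (leqnn _); rewrite tn => /(ler_wpM2r z0).
    lra.
  - by move=> j nj; apply: le_trans ay; apply: scale => w; exact: lines_le.
rewrite lebesgue_measure_itv/= lte_fin.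
case: ltP => [_|ci]; rewrite -?EFinB; congr EFin; lra.
Qed.

(** Trapezoids between the scaled breakpoints: the gap between roof and lines is
    affine on each of them, and one factor [z] comes from the base, one from the
    height. *)
Lemma slice_pyramid (z : R) : 0 <= z <= 1 ->
  plane_measure (ysection P z) = (area * z ^+ 2)%:E.
Proof.
move=> z01; have [z0 z1] := andP z01.
pose F := (@lebesgue_measure R \o xsection (ysection P z)).
have mF : measurable_fun [set: R] F.
  apply: measurable_fun_xsection.
  apply: measurable_ysection.
  exact: measurable_pyramid.
have -> : plane_measure (ysection P z) =
    (\int[lebesgue_measure]_(x in `[(t 0 * z)%R, (t n.+1 * z)%R]) F x)%E.
  rewrite [RHS]integral_mkcond; congr integral; apply/funext => x.
  rewrite patchE; case: ifPn => // /negP xlu.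
  rewrite /F/= (_ : xsection _ _ = set0) ?measure0//.
  apply/seteqP; split=> // y; rewrite fiberE /P /pyramid.
  by move=> [_ xlu' _ _]; apply: xlu; rewrite inE/= in_itv/= t0 tn.
rewrite (@ge0_integral_itv_nodes _ (fun i => t i * z) n.+1)//; last first.
  by move=> i ni; rewrite ler_wpM2r// t_le.
rewrite mulr_suml -sumEFin; apply: eq_bigr => i _.
have ni : (i <= n)%N by rewrite -ltnS.
rewrite (_ : integral _ _ _ = \int[lebesgue_measure]_(x in
    `[(t i * z)%R, (t i.+1 * z)%R]) ((s - a i) * x + (c - b i) * z)%:E)%E.
  rewrite integral_affine; last by rewrite ler_wpM2r// t_le.
  by congr EFin; rewrite /gap; field.
by apply: eq_integral => x; rewrite inE/= in_itv/=; exact: fiber_pyramid.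
Qed.

Lemma volume_pyramid : volume P = (area / 3)%:E.
Proof.
rewrite volume_slices; last exact: measurable_pyramid.
rewrite -integral_sqr01 [RHS]integral_mkcond; congr integral.
apply/funext => z; rewrite patchE; case: ifPn.
  by rewrite inE/= in_itv/= => z01; rewrite -slice_pyramid.
move=> /negP z01; rewrite /= (_ : ysection _ _ = set0) ?measure0//.
apply/seteqP; split=> // xy; rewrite /ysection/= !inE /P/pyramid/=.
by case: xy => x y [z01' _ _ _]; apply: z01; rewrite inE/= in_itv.
Qed.

End PyramidVolume.

(** * Convex polygonal paths *)

Lemma det_mx33_ones (R : realType) (x0 x1 x2 y0 y1 y2 : R) :
  \det (mx33 [:: [:: x0; x1; x2]; [:: y0; y1; y2]; [:: 1; 1; 1]]) =
  (x1 - x0) * (y2 - y0) - (x2 - x0) * (y1 - y0).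
Proof.
rewrite (expand_det_row _ ord0) !big_ord_recl big_ord0 /cofactor.
rewrite !(expand_det_row _ ord0) !big_ord_recl !big_ord0 /cofactor.
rewrite !det_mx11 !mxE/=.
by rewrite /bump/= !addn0 ?add0n ?addn1 ?exprS ?expr0; ring.
Qed.

(** With [T := t - t 0], each trapezoid
    [(T (i+1) - T i) * (d i + d (i+1))] is the triangle term
    [T (i+1) * d i - T i * d (i+1)] plus the increment of [T i * d i], which
    telescopes. *)
Lemma trapezoid_fan_sum (R : realType) (t d : nat -> R) (n : nat) :
  \sum_(i < n.+1) (t i.+1 - t i) * (d i + d i.+1) =
  (t 1%N - t 0%N) * d 0%N + (t n.+1 - t 0%N) * d n.+1 +
  \sum_(1 <= i < n.+1) ((t i.+1 - t 0%N) * d i - (t i - t 0%N) * d i.+1).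
Proof.
elim: n => [|n IH].
  by rewrite big_ord_recr big_ord0 big_geq//=; ring.
by rewrite big_ord_recr/= IH [in RHS]big_nat_recr//=; ring.
Qed.

Section ConvexPolygonalPath.
Variables (R : realType) (n : nat) (t y a b : nat -> R).
Hypothesis t_le : forall i, (i <= n)%N -> t i <= t i.+1.
Hypothesis slope_le : forall i, (i < n)%N -> a i <= a i.+1.
Hypothesis y_left : forall i, (i <= n)%N -> y i = a i * t i + b i.
Hypothesis y_right : forall i, (i <= n)%N -> y i.+1 = a i * t i.+1 + b i.

Lemma nodes_le i j : (i <= j)%N -> (j <= n.+1)%N -> t i <= t j.
Proof.
move=> ij; rewrite -(subnK ij); elim: (j - i)%N => // m IH mn.
by rewrite (le_trans (IH (ltnW mn)))// t_le.
Qed.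

Lemma lines_cross i x : (i < n)%N ->
  a i.+1 * x + b i.+1 - (a i * x + b i) = (a i.+1 - a i) * (x - t i.+1).
Proof.
by move=> ni; have := y_left ni; rewrite y_right ?(ltnW ni)// => e; lra.
Qed.

(** Moving the index [j] away from [i], each step passes a breakpoint beyond
    [x], and by [lines_cross] the line past a breakpoint is the lower one before
    it. *)
Lemma lines_le_active i j x : (i <= n)%N -> (j <= n)%N ->
  t i <= x <= t i.+1 -> a j * x + b j <= a i * x + b i.
Proof.
move=> + + /andP[]; have [ji|ij] := leqP j i.
- move=> + _ + _; rewrite -(subnK ji).
  elim: (i - j)%N => // m IH mn tx; apply: (le_trans (IH (ltnW mn) _)).
    by apply: le_trans tx; exact/t_le/ltnW.
  by rewrite -subr_ge0 addSn lines_cross// mulr_ge0 ?subr_ge0 ?slope_le.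
- move=> _ + _ xt; rewrite -(subnK (ltnW ij)).
  elim: (j - i)%N => // m IH mn; apply: le_trans (IH (ltnW mn)).
  rewrite -subr_le0 addSn lines_cross//.
  rewrite mulr_ge0_le0 ?subr_ge0 ?slope_le// subr_le0 (le_trans xt)//.
  by apply: nodes_le; [rewrite ltnS leq_addl|exact: leqW].
Qed.

Let g := piecewise_linear t y n.+1.

Lemma piecewise_linear_active x : t 0%N <= x <= t n.+1 ->
  exists i, [/\ (i <= n)%N, t i <= x <= t i.+1 & g x = a i * x + b i].
Proof.
move=> /andP[x0 xn]; rewrite /g.
suff H m : (m <= n.+1)%N -> x <= t m ->
    exists i, [/\ (i <= n)%N, t i <= x <= t i.+1 &
                  piecewise_linear t y m x = a i * x + b i].
  exact: H.
elim: m => [_ xt|m IH mn xt].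
  have -> : x = t 0%N by apply/eqP; rewrite eq_le xt.
  by exists 0%N; rewrite lexx t_le// -y_left.
rewrite /=; case: leP => [xm|mx]; first by apply: IH => //; exact: ltnW.
exists m; rewrite xt ltW//; split=> //.
have tm : t m.+1 - t m != 0 by rewrite gt_eqF// subr_gt0 (lt_le_trans mx).
by rewrite y_right// y_left//; field.
Qed.

(** If breakpoints coincide, the edge selected at [t i] need not be adjacent to
    node [i] in the numbering; its line and the line of an adjacent edge are
    both highest there, hence agree. *)
Lemma piecewise_linear_node i : (i <= n.+1)%N -> g (t i) = y i.
Proof.
move=> ni.
have [j [nj tj ->]] : exists j, [/\ (j <= n)%N, t j <= t i <= t j.+1 &
    y i = a j * t i + b j].
  move: ni; rewrite leq_eqVlt => /predU1P[->|ni].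
    by exists n; rewrite lexx t_le// y_right.
  by exists i; rewrite lexx t_le// y_left.
have [|k [nk tk ->]] := @piecewise_linear_active (t i).
  by rewrite !nodes_le.
by apply/eqP; rewrite eq_le !lines_le_active.
Qed.

(** The formula holds for every nonnegative convex polygonal path, whether or
    not it comes from tangents.  The chord lies above every line because it does
    so at both ends.  The determinant of triangle [i] has constant sign because
    it is [t (i+1) - t i] times the height of the first vertex above line
    [i]. *)
Lemma volume_perspective_polygonal : t 0%N < t n.+1 ->
  (forall x, t 0%N <= x <= t n.+1 -> 0 <= g x) ->
  volume (perspective_relaxation (t 0%N) (t n.+1) g) =
  (6^-1 * \sum_(1 <= i < n.+1)
     `| \det (mx33 [:: [:: t 0%N; t i; t i.+1];
                       [:: g (t 0%N); g (t i); g (t i.+1)];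
                       [:: 1; 1; 1]]) |)%:E.
Proof.
move=> lu g0.
set l := t 0%N in lu g0 *; set u := t n.+1 in lu g0 *.
rewrite (@perspective_relaxation_pyramid _ _ _ n a b)//; last 2 first.
- move=> x i /piecewise_linear_active[j [nj tj ->]] ni.
  exact: lines_le_active.
- by move=> x /piecewise_linear_active[j [nj tj ->]]; exists j.
set s := (g u - g l) / (u - l); set c := g l - s * l.
have lr : c + s * l = g l by rewrite /c subrK.
have ur : c + s * u = g u.
  rewrite -[RHS](subrK (g l)) -[g u - g l](@divfK _ (u - l)) -/s.
    by rewrite /c; ring.
  by rewrite subr_eq0 gt_eqF.
have line_le_g i x : (i <= n)%N -> l <= x <= u -> a i * x + b i <= g x.
  by move=> ni /piecewise_linear_active[j [nj tj ->]]; exact: lines_le_active.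
have lul : l <= l <= u by rewrite lexx ltW.
have luu : l <= u <= u by rewrite lexx ltW.
rewrite (@volume_pyramid _ _ _ n t)//; last first.
- move=> i x ni /andP[ti xt].
  have lx : l <= x by apply: le_trans ti; apply: nodes_le => //; exact: leqW.
  have xu : x <= u by apply: le_trans xt _; apply: nodes_le.
  have := line_le_g i l ni lul; have := line_le_g i u ni luu.
  rewrite -lr -ur => hu hl.
  rewrite -subr_ge0 -(pmulr_rge0 _ (_ : 0 < u - l)) ?subr_gt0//.
  have -> : (u - l) * (c + s * x - (a i * x + b i)) =
    (u - x) * (c + s * l - (a i * l + b i)) +
    (x - l) * (c + s * u - (a i * u + b i)) by ring.
  by rewrite addr_ge0// mulr_ge0// subr_ge0.
- exact: lines_le_active.
(* The vertical distance from the path to its chord, zero at both ends. *)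
pose d i := c + s * t i - y i.
congr EFin; rewrite -mulr_suml.
under eq_bigr => i _.
  have ni : (i <= n)%N by rewrite -ltnS.
  rewrite -y_left// -y_right// -/(d i) -/(d i.+1).
  over.
rewrite trapezoid_fan_sum.
have -> : d 0%N = 0.
  by rewrite /d -/l lr /l piecewise_linear_node// subrr.
have -> : d n.+1 = 0.
  by rewrite /d -/u ur /u piecewise_linear_node// subrr.
rewrite !mulr0 !add0r.
have div6 (v : R) : v / 2 / 3 = 6^-1 * v by field.
rewrite div6; congr (_ * _); rewrite !big_nat; apply: eq_bigr => i /andP[i0 ni].
rewrite ltnS in ni.
rewrite det_mx33_ones !piecewise_linear_node ?(leqW ni)//.
have -> : (t i - l) * (y i.+1 - y 0%N) - (t i.+1 - l) * (y i - y 0%N) =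
    (t i.+1 - l) * d i - (t i - l) * d i.+1.
  have : y 0%N = c + s * l by rewrite lr /l piecewise_linear_node.
  by rewrite /d => ->; ring.
rewrite ger0_norm//.
have := line_le_g i l ni lul.
have ti := t_le ni.
rewrite -lr /d y_left// y_right// => hl.
have -> : (t i.+1 - l) * (c + s * t i - (a i * t i + b i)) -
  (t i - l) * (c + s * t i.+1 - (a i * t i.+1 + b i)) =
  (t i.+1 - t i) * (c + s * l - (a i * l + b i)) by ring.
by rewrite mulr_ge0// subr_ge0.
Qed.

End ConvexPolygonalPath.

(** * Tangents of a convex function *)

Section Tangents.
Variables (R : realType) (l u : R) (f : R -> R).
Hypothesis f_convex : convex_function (E := R^o) `[l, u]%classic f.

Lemma convex_chord p x k : l <= p <= u -> l <= x <= u -> 0 <= k <= 1 ->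
  f (p + k * (x - p)) - f p <= k * (f x - f p).
Proof.
move=> pI xI /andP[k0 k1].
have /(_ (x : R^o) (p : R^o)) := f_convex (Itv01 k0 k1).
rewrite !inE/= !in_itv/= => /(_ xI pI).
change (f (k * x + (1 - k) * p) <= k * f x + (1 - k) * f p ->
        f (p + k * (x - p)) - f p <= k * (f x - f p)).
have -> : p + k * (x - p) = k * x + (1 - k) * p by ring.
lra.
Qed.

(** Divide [convex_chord] by [k] and let [k] tend to [0] from the right: the
    left side tends to the derivative times [x - p].  The point
    [p + k * (x - p)] stays in [[l, u]] and avoids [p], so this covers one-sided
    derivatives and both positions of [x]. *)
Lemma tangent_le p x : l <= p <= u -> l <= x <= u -> derivable_on l u f p ->
  f p + derive_on l u f p * (x - p) <= f x.
Proof.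
move=> pI xI df; have [->|xp] := eqVneq x p.
  by rewrite subrr mulr0 addr0.
have xp0 : x - p != 0 by rewrite subr_eq0.
pose h (k : R) := p + k * (x - p).
have h0 : h 0 = p by rewrite /h mul0r addr0.
have approach : h k @[k --> 0^'+] --> within `[l, u] p^'.
  have hp : h k @[k --> 0^'+] --> p.
    rewrite -[X in _ --> X]h0; apply: cvg_within_filter.
    apply: cvgD; first exact: cvg_cst.
    by apply: cvgM; [exact: cvg_id|exact: cvg_cst].
  move=> A; rewrite /within/= => pA.
  have {}pA : \forall y \near p, y != p -> y \in `[l, u] -> A y by [].
  have := hp _ pA; rewrite /= => {}hp.
  rewrite /nbhs/=; near=> k.
  have k0 : 0 < k by [].
  have k1 : k <= 1 by near: k; exact: nbhs_right_le.
  have : h k != p -> h k \in `[l, u] -> A (h k) by near: k.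
  apply.
    by rewrite /h addrC -subr_eq0 addrK mulf_neq0// gt_eqF.
  by rewrite in_itv/= /h; nra.
have slopes : (f (h k) - f p) / (h k - p) @[k --> 0^'+] -->
    derive_on l u f p by exact: cvg_comp approach df.
rewrite -lerBrDl.
have scaled : (f (h k) - f p) / (h k - p) * (x - p) @[k --> 0^'+] -->
    derive_on l u f p * (x - p) by apply: cvgM => //; exact: cvg_cst.
apply: (closed_cvg _ (@closed_le _ (f x - f p)) _ _ scaled).
near=> k.
have k0 : 0 < k by [].
have k1 : k <= 1 by near: k; exact: nbhs_right_le.
have -> : h k - p = k * (x - p) by rewrite /h addrC addKr.
rewrite /= invfM mulrA divfK// ler_pdivrMr// mulrC.
by apply: convex_chord => //; rewrite ltW.
Unshelve. all: by end_near. Qed.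

End Tangents.

Definition tangent_slope (R : realType) (l u : R) (f : R -> R)
    (xi : nat -> R) (i : nat) : R := derive_on l u f (xi i).

Definition tangent_intercept (R : realType) (l u : R) (f : R -> R)
    (xi : nat -> R) (i : nat) : R := f (xi i) - tangent_slope l u f xi i * xi i.

Section TangentPolygon.
Variables (R : realType) (l u : R) (f : R -> R) (n : nat) (xi : nat -> R).
Hypothesis f_convex : convex_function (E := R^o) `[l, u]%classic f.
Hypothesis xi0 : xi 0%N = l.
Hypothesis xin : xi n = u.
Hypothesis xi_lt : forall i, (i < n)%N -> xi i < xi i.+1.
Hypothesis f_derivable : forall i, (i <= n)%N -> derivable_on l u f (xi i).

Local Notation t := (tau l u f n xi).
Local Notation a := (tangent_slope l u f xi).
Local Notation b := (tangent_intercept l u f xi).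

Lemma xi_itv i : (i <= n)%N -> l <= xi i <= u.
Proof.
have mono j k : (j <= k)%N -> (k <= n)%N -> xi j <= xi k.
  move=> jk; rewrite -(subnK jk); elim: (k - j)%N => // m IH mn.
  by rewrite (le_trans (IH (ltnW mn)))// ltW// xi_lt.
by move=> ni; rewrite -xi0 -xin !mono.
Qed.

Lemma tangent_line_le i x : (i <= n)%N -> l <= x <= u -> a i * x + b i <= f x.
Proof.
move=> ni xI; have := tangent_le f_convex (xi_itv ni) xI (f_derivable ni).
rewrite /tangent_intercept /tangent_slope; lra.
Qed.

(** Each of the two tangents lies below [f] at the other point of tangency. *)
Lemma tangent_slope_le i : (i < n)%N -> a i <= a i.+1.
Proof.
move=> ni; have d := xi_lt ni.
have := tangent_line_le (ltnW ni) (xi_itv ni).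
have := tangent_line_le ni (xi_itv (ltnW ni)).
rewrite /tangent_intercept; nra.
Qed.

Lemma tauS i : (i < n)%N ->
  t i.+1 = if a i == a i.+1 then (xi i + xi i.+1) / 2
           else (b i.+1 - b i) / (a i - a i.+1).
Proof. by move=> ni; rewrite /t /tau/= eqSS ltn_eqF. Qed.

Lemma tau0 : t 0%N = l. Proof. by []. Qed.

Lemma tau_last : t n.+1 = u. Proof. by rewrite /tau/= eqxx. Qed.

(** For equal slopes the two lines coincide, since each lies below the other at
    one point; then every abscissa is a meeting point. *)
Lemma tangents_meet i : (i < n)%N ->
  a i * t i.+1 + b i = a i.+1 * t i.+1 + b i.+1.
Proof.
move=> ni; rewrite tauS//; case: eqVneq => [e|ne].
  have := tangent_line_le (ltnW ni) (xi_itv ni).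
  have := tangent_line_le ni (xi_itv (ltnW ni)).
  by rewrite /tangent_intercept -e; lra.
have : a i - a i.+1 != 0 by rewrite subr_eq0.
by move=> ?; field.
Qed.

(** At each of the two points of tangency the tangent taken there is the higher
    one, so the difference of the two changes sign in between. *)
Lemma tau_between i : (i < n)%N -> xi i <= t i.+1 <= xi i.+1.
Proof.
move=> ni; rewrite tauS//; case: eqVneq => [e|ne].
  by have := xi_lt ni; lra.
have a_lt : 0 < a i.+1 - a i.
  by rewrite subr_gt0 lt_neqAle ne tangent_slope_le.
have -> : (b i.+1 - b i) / (a i - a i.+1) = (b i - b i.+1) / (a i.+1 - a i).
  by rewrite -opprB -[a i - _]opprB invrN mulrNN.
rewrite ler_pdivlMr// ler_pdivrMr//.
have := tangent_line_le (ltnW ni) (xi_itv ni).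
have := tangent_line_le ni (xi_itv (ltnW ni)).
rewrite /tangent_intercept; lra.
Qed.

(** Breakpoints and points of tangency interlace. *)
Lemma tau_le i : (i <= n)%N -> t i <= t i.+1.
Proof.
move=> ni; apply: (@le_trans _ _ (xi i)).
  case: i ni => [|i] ni; first by rewrite tau0 xi0.
  by have /andP[] := tau_between ni.
move: ni; rewrite leq_eqVlt => /predU1P[->|ni]; first by rewrite tau_last xin.
by have /andP[] := tau_between ni.
Qed.

Lemma ordinate_left i : (i <= n)%N ->
  ordinate l u f n xi i = a i * t i + b i.
Proof.
case: i => [|i] ni; rewrite /ordinate/=.
  by rewrite tau0 /tangent_intercept xi0; ring.
by rewrite eqSS ltn_eqF// /tangent_intercept /tangent_slope; ring.
Qed.

Lemma ordinate_right i : (i <= n)%N ->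
  ordinate l u f n xi i.+1 = a i * t i.+1 + b i.
Proof.
rewrite leq_eqVlt => /predU1P[->|ni].
  by rewrite /ordinate/= eqxx tau_last /tangent_intercept xin; ring.
by rewrite ordinate_left// tangents_meet.
Qed.

End TangentPolygon.

Theorem theorem2p1 (R : realType) (l u : R) (f : R -> R) (n : nat)
    (xi : nat -> R) :
  0 <= l -> l < u ->
  (forall x, x \in `[l, u] -> 0 < f x) ->
  convex_function (E := R^o) `[l, u]%classic f ->
  (1 <= n)%N -> xi 0%N = l -> xi n = u ->
  (forall i, (i < n)%N -> xi i < xi i.+1) ->
  (forall i, (i <= n)%N -> derivable_on l u f (xi i)) ->
  let t := tau l u f n xi in
  let g := under_estimator l u f n xi in
  (forall x, x \in `[l, u] -> 0 <= g x) ->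
  volume (perspective_relaxation l u g) =
  (6^-1 * \sum_(1 <= i < n.+1)
     `| \det (mx33 [:: [:: t 0%N; t i; t i.+1];
                       [:: g (t 0%N); g (t i); g (t i.+1)];
                       [:: 1; 1; 1]]) |)%:E.
Proof.
move=> _ lu _ f_convex _ xi0 xin xi_lt f_derivable t g g0.
have tn : t n.+1 = u := tau_last l u f n xi.
rewrite -[X in perspective_relaxation _ X]tn.
apply: (@volume_perspective_polygonal _ n t (ordinate l u f n xi)
  (tangent_slope l u f xi) (tangent_intercept l u f xi)).
- exact: (tau_le f_convex xi0 xin xi_lt f_derivable).
- exact: (tangent_slope_le f_convex xi0 xin xi_lt f_derivable).
- by move=> i ni; exact: ordinate_left.
- exact: (ordinate_right f_convex xi0 xin xi_lt f_derivable).
- by rewrite tn.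
- by move=> x; rewrite tn => xI; apply: g0; rewrite in_itv.
Qed.
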